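(* Let $p$ be an odd prime and $g\ge 1$ an integer. For all integers $i,j$ with $1\le i,j\le g$, the polynomial $c_{ip-j}\in\mathbb{F}_p[z_1,\ldots,z_{2g-1}]$ (an entry of the Cartier--Manin matrix) satisfies $$\mathcal{D}_\ell^{(j)}\, c_{ip-j}=0\qquad\text{for } \ell=1,2,\ldots,2g-1,$$ and $$\mathcal{D}_{\ell,m}\, c_{ip-j}=0\qquad\text{for } 1\le \ell<m\le 2g-1.$$
   Context: Let $f(x)=x(x-1)(x-z_1)(x-z_2)\cdots(x-z_{2g-1})$ with $z_1,\ldots,z_{2g-1}$ indeterminates over $\mathbb{F}_p$. For an integer $k$, $c_k\in\mathbb{F}_p[z_1,\ldots,z_{2g-1}]$ denotes the coefficient of $x^k$ in $f(x)^{(p-1)/2}$ (so $c_k=0$ if $k<0$ or $k>(p-1)(2g+1)/2$). The matrix $(c_{ip-j})_{1\le i,j\le g}$ is the Cartier--Manin matrix of $y^2=f(x)$. For $j\in\{1,\ldots,g\}$ put $a=(2g+1)/2-j$, $b=1/2$, $c=g-j+1$, regarded as elements of $\mathbb{F}_p$. For $\ell\in\{1,\ldots,2g-1\}$ define the differential operator on $\mathbb{F}_p[z_1,\ldots,z_{2g-1}]$ $$\mathcal{D}_\ell^{(j)}=z_\ell(1-z_\ell)\frac{\partial^2}{\partial z_\ell^2}+\sum_{\substack{1\le k\le 2g-1\\ k\ne \ell}} z_k(1-z_\ell)\frac{\partial^2}{\partial z_\ell\partial z_k}+\bigl(c-(a+b+1)z_\ell\bigr)\frac{\partial}{\partial z_\ell}-\sum_{\substack{1\le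 k\le 2g-1\\ k\ne \ell}} b\, z_k\frac{\partial}{\partial z_k}-ab,$$ and for $1\le \ell<m\le 2g-1$ define $$\mathcal{D}_{\ell,m}=(z_\ell-z_m)\frac{\partial^2}{\partial z_\ell\partial z_m}-\frac12\frac{\partial}{\partial z_\ell}+\frac12\frac{\partial}{\partial z_m}.$$ *)

(* Defs.v *)
From mathcomp Require Import all_boot all_order all_algebra.
From mathcomp Require Export mpoly.

Set Implicit Arguments.
Unset Strict Implicit.
Unset Printing Implicit Defensive.

Import GRing.Theory.
Local Open Scope ring_scope.

(* f lives in F_p[z_1, ..., z_(2g-1)][x]: x is the outer variable, and z_l,
   1 <= l <= 2g-1, is 'X_(l-1), since ordinals start at 0. *)
Definition hyp_f (p g : nat) : {poly {mpoly 'F_p[(2 * g - 1)%N]}} :=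
  'X * ('X - 1) * \prod_(l < 2 * g - 1) ('X - ('X_l)%:P).

(* Indexed by int because i * p - j can be negative, where the coefficient is 0
   (truncated subtraction would instead pick the constant coefficient). *)
Definition coef_c (p g : nat) (k : int) : {mpoly 'F_p[(2 * g - 1)%N]} :=
  match k with
  | Posz m => (hyp_f p g ^+ ((p - 1) %/ 2))`_m
  | Negz _ => 0
  end.

Definition par_a (p g j : nat) : 'F_p := (2 * g + 1)%N%:R / 2%:R - j%:R.
Definition par_b (p : nat) : 'F_p := 1 / 2%:R.
Definition par_c (p g j : nat) : 'F_p := g%:R - j%:R + 1.

Definition D1 (p g j : nat) (l : 'I_(2 * g - 1))
    (P : {mpoly 'F_p[(2 * g - 1)%N]}) : {mpoly 'F_p[(2 * g - 1)%N]} :=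
  let a := par_a p g j in
  let b := par_b p in
  let c := par_c p g j in
    'X_l * (1 - 'X_l) * mderiv l (mderiv l P)
  + \sum_(k < 2 * g - 1 | k != l) 'X_k * (1 - 'X_l) * mderiv l (mderiv k P)
  + (c%:MP - (a + b + 1) *: 'X_l) * mderiv l P
  - \sum_(k < 2 * g - 1 | k != l) (b *: 'X_k) * mderiv k P
  - (a * b) *: P.

Definition D2 (p g : nat) (l m : 'I_(2 * g - 1))
    (P : {mpoly 'F_p[(2 * g - 1)%N]}) : {mpoly 'F_p[(2 * g - 1)%N]} :=
    ('X_l - 'X_m) * mderiv l (mderiv m P)
  - (1 / 2%:R : 'F_p) *: mderiv l P
  + (1 / 2%:R : 'F_p) *: mderiv m P.

(* Main.v *)
(* Put n = (p-1)/2 and F = f^n, so that n = -1/2 in F_p.  From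
   (x - z_l) d_l F = - n F every second derivative of F in the z's is reduced
   to first ones, which gives D_{l,m} F = 0 at once.  With a, b, c expressed
   through n, the same relations show that D_l^(j) F = x H' + j H for
   H = (x - 1) d_l F; its coefficient at x^k is (k + j) H_k, which vanishes
   for k = ip - j. *)
Require Import Defs.
From mathcomp Require Import all_boot all_order all_algebra.
From mathcomp Require Import ring.
Import GRing.Theory.
Local Open Scope ring_scope.

(* Used with y = z_l, u = d_l F, w = d_l^2 F, V = u' and the sums
   P = \sum_(k != l) z_k d_k F, T = \sum_(k != l) z_k d_l d_k F,
   S = \sum_k d_k d_l F. *)
Lemma hypergeometric_elimination {B : comNzRingType} {N n : nat} (j : nat)
    {x y F u w T P S V : B} :
    (x - y) * u = - (n%:R * F) ->
    (x - y) * w = (1 - n%:R) * u ->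
    n%:R * P = - (x - y) * T ->
    x * S = T - N%:R * n%:R * u + n%:R * u + x * w ->
    x * (x - 1) * V = n%:R * (x *+ 2 - 1) * u - (x - 1) * (x * S) ->
  y * (1 - y) * w + (1 - y) * T
  + (1 - (N.+1 * n + j)%:R - (1 - (N.+3 * n + j)%:R) * y) * u
  + n%:R * P - (n * (N.+2 * n + j))%:R * F
  = x * (u + (x - 1) * V) + j%:R * ((x - 1) * u).
Proof.
move=> Eu Ew EP ES EV.
have -> : x * (u + (x - 1) * V) = x * u + x * (x - 1) * V by ring.
have -> : (n * (N.+2 * n + j))%:R * F = (N.+2 * n + j)%:R * (n%:R * F).
  by rewrite mulrA -natrM mulnC.
rewrite EP EV ES -[n%:R * F]opprK -Eu.
apply/eqP; rewrite -subr_eq0; apply/eqP.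
(* All terms in [T] cancel, and [w] keeps the coefficient [y * (1 - y) + x * (x - 1) = (x - y) * (x
   + y - 1)]; hence the difference is [x + y - 1] times the relation [Ew]. *)
transitivity ((x + y - 1) * ((x - y) * w - (1 - n%:R) * u)).
  ring.
by rewrite Ew subrr mulr0.
Qed.

(** * Partial derivatives in the z's on polynomials in x, with x held constant *)

Section CoefficientwiseDerivation.
Set Implicit Arguments.
Unset Strict Implicit.
Variables (R : comNzRingType) (N : nat).
Local Notation A := {mpoly R[N]}.
Implicit Types (k l : 'I_N) (P Q : {poly A}).

Definition pmderiv l P : {poly A} := map_poly (mderiv l) P.

Lemma coef_pmderiv l P i : (pmderiv l P)`_i = mderiv l P`_i.
Proof. exact: coef_map. Qed.

Lemma pmderivD l P Q : pmderiv l (P + Q) = pmderiv l P + pmderiv l Q.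
Proof. exact: raddfD. Qed.

Lemma pmderivB l P Q : pmderiv l (P - Q) = pmderiv l P - pmderiv l Q.
Proof. exact: raddfB. Qed.

Lemma pmderiv_sum l (I : finType) (E : I -> {poly A}) :
  pmderiv l (\sum_i E i) = \sum_i pmderiv l (E i).
Proof. exact: raddf_sum. Qed.

Lemma pmderivM l P Q :
  pmderiv l (P * Q) = pmderiv l P * Q + P * pmderiv l Q.
Proof.
apply/polyP=> i; rewrite coefD coef_pmderiv !coefM raddf_sum /= -big_split.
by apply: eq_bigr => j _; rewrite mderivM !coef_pmderiv.
Qed.

Lemma pmderivC l (a : A) : pmderiv l a%:P = (mderiv l a)%:P.
Proof. exact: map_polyC. Qed.

Lemma pmderiv_nat l m : pmderiv l m%:R = 0.
Proof. by rewrite -polyC_natr pmderivC -mpolyC_nat mderivC polyC0. Qed.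

Lemma pmderiv1 l : pmderiv l 1 = 0.
Proof. exact: (pmderiv_nat l 1). Qed.

Lemma pmderivN l P : pmderiv l (- P) = - pmderiv l P.
Proof. exact: raddfN. Qed.

Lemma pmderiv_natM l m P : pmderiv l (m%:R * P) = m%:R * pmderiv l P.
Proof. by rewrite pmderivM pmderiv_nat mul0r add0r. Qed.

Lemma pmderivX l : pmderiv l 'X = 0.
Proof.
apply/polyP=> i; rewrite coef_pmderiv coefX coef0.
by rewrite -mpolyC_nat mderivC.
Qed.

Lemma mderiv_var l k : mderiv l ('X_k : A) = (l == k)%:R.
Proof.
rewrite mderivX mnm1E eq_sym; case: eqP => [->|_]; last by rewrite scale0r.
by rewrite -[X in (X - _)%MM]add0m addmK mpolyX0 scale1r.
Qed.

Lemma pmderiv_linear l k : pmderiv l ('X - ('X_k)%:P) = - (l == k)%:R.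
Proof. by rewrite pmderivB pmderivX pmderivC mderiv_var polyC_natr sub0r. Qed.

Lemma pmderiv_exp l P m : pmderiv l (P ^+ m) = m%:R * (P ^+ m.-1 * pmderiv l P).
Proof.
elim: m => [|m IHm]; first by rewrite expr0 pmderiv1 mul0r.
rewrite exprS pmderivM IHm; case: m {IHm} => [|m] /=.
  by rewrite expr0; ring.
by rewrite exprS -[m.+2]addn1 natrD; ring.
Qed.

(** Only the factor of index [l] involves [z_l], and its derivative is -1. *)
Lemma pmderiv_prod_linear l :
  pmderiv l (\prod_k ('X - ('X_k)%:P)) = - \prod_(k | k != l) ('X - ('X_k)%:P).
Proof.
rewrite (bigD1 l) //= pmderivM pmderiv_linear eqxx mulN1r.
suff ->: pmderiv l (\prod_(k | k != l) ('X - ('X_k)%:P)) = 0.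
  by rewrite mulr0 addr0.
apply: (big_ind (fun P => pmderiv l P = 0)) => [|P Q P0 Q0|k /negPf kl].
- exact: pmderiv1.
- by rewrite pmderivM P0 Q0 mul0r mulr0 addr0.
- by rewrite pmderiv_linear eq_sym kl oppr0.
Qed.

Lemma pmderiv_comm k l P : pmderiv k (pmderiv l P) = pmderiv l (pmderiv k P).
Proof. by apply/polyP=> i; rewrite !coef_pmderiv mderiv_comm. Qed.

Lemma pmderiv_deriv l P : (pmderiv l P)^`() = pmderiv l P^`().
Proof. by apply/polyP=> i; rewrite !(coef_deriv, coef_pmderiv) raddfMn. Qed.

(* The derivation d/dx + \sum_l d/dz_l kills every factor. *)
Lemma deriv_prod_linear :
  (\prod_k ('X - ('X_k)%:P))^`() =
    - \sum_l pmderiv l (\prod_k ('X - ('X_k)%:P)) :> {poly A}.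
Proof.
apply/eqP; rewrite -addr_eq0; apply/eqP.
apply: (big_ind (fun P => P^`() + \sum_l pmderiv l P = 0)) => [|P Q P0 Q0|k _].
- by rewrite derivC add0r big1 // => l _; exact: pmderiv1.
- rewrite derivM; under eq_bigr do rewrite pmderivM.
  rewrite big_split -mulr_suml -mulr_sumr addrACA -mulrDl -mulrDr.
  by rewrite P0 Q0 mul0r mulr0 addr0.
- under eq_bigr do rewrite pmderiv_linear.
  rewrite derivB derivX derivC subr0 sumrN (bigD1 k) //= eqxx.
  by rewrite big1 ?addr0 ?subrr // => l /negPf->.
Qed.

(** * Differential relations for f and its power F *)

Variable n : nat.
Local Notation z k := (('X_k : A)%:P).
Local Notation "''d_' k P" := (pmderiv k P)
  (at level 10, k at level 2, P at level 9).

(* [hyp_f] over an abstract ring, since unification diverges over the concrete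
   ring 'F_p. *)
Definition hyp_poly : {poly A} := 'X * ('X - 1) * \prod_k ('X - z k).
Local Notation f := hyp_poly.
Local Notation F := (hyp_poly ^+ n).

Lemma pmderiv_X1 l : 'd_l ('X - 1) = 0.
Proof. by rewrite pmderivB pmderiv1 subr0; exact: pmderivX. Qed.

Lemma pmderiv_XX1 l : 'd_l ('X * ('X - 1)) = 0.
Proof.
have dX : 'd_l 'X = 0 by exact: pmderivX.
by rewrite pmderivM pmderiv_X1 dX mul0r mulr0 addr0.
Qed.

Lemma pmderiv_hyp_poly l :
  'd_l f = - ('X * ('X - 1) * \prod_(k | k != l) ('X - z k)).
Proof.
rewrite /hyp_poly pmderivM pmderiv_prod_linear.
by rewrite pmderiv_XX1 mul0r add0r mulrN.
Qed.

Lemma linear_mul_pmderiv_hyp_poly l : ('X - z l) * 'd_l f = - f.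
Proof.
by rewrite pmderiv_hyp_poly /hyp_poly [in RHS](bigD1 l) //= mulrN mulrCA.
Qed.

(** The derivation [d/dx + \sum_l d_l] kills the product of the [x - z_k], so on [f] it acts only
    through [x (x - 1)], with derivative [2 x - 1]. This trades [d/dx] for the [d_l]. *)
Lemma deriv_hyp_poly :
  'X * ('X - 1) * f^`() =
    ('X *+ 2 - 1) * f - 'X * ('X - 1) * \sum_l 'd_l f.
Proof.
rewrite {1}/hyp_poly derivM deriv_prod_linear.
have -> : \sum_l 'd_l f =
    'X * ('X - 1) * \sum_l 'd_l (\prod_k ('X - z k)).
  rewrite mulr_sumr; apply: eq_bigr => l _.
  by rewrite pmderiv_hyp_poly pmderiv_prod_linear mulrN.
rewrite derivM derivB derivX derivC /hyp_poly.
by set S := \sum_l _; set Q := \prod_k _; ring.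
Qed.

(** The factor [m%:R] absorbs the case [m = 0], where [m.-1] truncates to 0. *)
Lemma natr_mul_exp_pred (B : nzRingType) (P : B) m :
  m%:R * P ^+ m = m%:R * (P * P ^+ m.-1).
Proof. by case: m => [|m]; rewrite ?mul0r // exprS. Qed.

Lemma linear_mul_pmderiv l : ('X - z l) * 'd_l F = - (n%:R * F).
Proof.
rewrite pmderiv_exp natr_mul_exp_pred !(mulrCA ('X - z l)).
by rewrite linear_mul_pmderiv_hyp_poly !mulrN (mulrC _ f).
Qed.

Lemma deriv_exp_hyp_poly :
  'X * ('X - 1) * F^`() =
    n%:R * ('X *+ 2 - 1) * F - 'X * ('X - 1) * \sum_l 'd_l F.
Proof.
under eq_bigr do rewrite pmderiv_exp mulrA.
rewrite -mulr_sumr deriv_exp -mulr_natl.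
have -> : 'X * ('X - 1) * (n%:R * (f^`() * f ^+ n.-1)) =
    n%:R * f ^+ n.-1 * ('X * ('X - 1) * f^`()).
  by ring.
rewrite deriv_hyp_poly.
rewrite -[n%:R * _ * F]mulrA (mulrCA n%:R) natr_mul_exp_pred.
ring.
Qed.

(** Apply [d_l] to the first-order relation for [z_k]; the Kronecker delta comes from
    differentiating [x - z_k]. *)
Lemma linear_mul_pmderiv2 k l :
  ('X - z k) * 'd_k ('d_l F) = ((k == l)%:R - n%:R) * 'd_l F.
Proof.
have := congr1 (pmderiv l) (linear_mul_pmderiv k).
rewrite pmderivM pmderiv_linear pmderivN pmderiv_natM (pmderiv_comm l k).
move=> E; apply: (addrI (- (l == k)%:R * 'd_k F)); rewrite E.
by case: eqVneq => [->|_] /=; ring.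
Qed.

(** Subtracting the two second-order relations for [d_l d_m F] eliminates x from the multiplier, so
    the identity can be read on each coefficient. *)
Lemma pmderiv2_neq l m : l != m ->
  (z l - z m) * 'd_l ('d_m F) = n%:R * 'd_m F - n%:R * 'd_l F.
Proof.
move=> lm; have := linear_mul_pmderiv2 l m; have := linear_mul_pmderiv2 m l.
rewrite (pmderiv_comm m l) eq_sym (negPf lm) => Em El.
have -> : (z l - z m) * 'd_l ('d_m F) =
  ('X - z m) * 'd_l ('d_m F) - ('X - z l) * 'd_l ('d_m F) by ring.
by rewrite [X in X - _]Em [X in _ - X]El !sub0r !mulNr opprK addrC.
Qed.

(** This is the operator with [a = -((N + 2) n + j)], [b = -n] and [c = 1 - ((N + 1) n + j)], over
    any commutative ring; the value [n = -1/2] enters only when these are matched with the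
    parameters in ['F_p]. *)
Lemma hypergeometric_pmderiv j l (H := ('X - 1) * 'd_l F) :
  z l * (1 - z l) * 'd_l ('d_l F)
  + (1 - z l) * \sum_(k | k != l) z k * 'd_l ('d_k F)
  + (1 - (N.+1 * n + j)%:R - (1 - (N.+3 * n + j)%:R) * z l) * 'd_l F
  + n%:R * \sum_(k | k != l) z k * 'd_k F
  - (n * (N.+2 * n + j))%:R * F
  = 'X * H^`() + j%:R * H.
Proof.
set T := \sum_(k | k != l) z k * 'd_l ('d_k F).
have ET : n%:R * \sum_(k | k != l) z k * 'd_k F = - ('X - z l) * T.
  rewrite !mulr_sumr; apply: eq_bigr => k kl.
  have := linear_mul_pmderiv2 l k; rewrite eq_sym (negPf kl) => E.
  by rewrite mulrCA mulNr [in RHS]mulrCA E sub0r mulNr mulrN opprK.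
(* Split x as [(x - z_k) + z_k] in each term with [k != l]: the first part gives [-n d_l F], [N - 1]
   times in all, and the second parts add up to [T]. *)
have ES : 'X * \sum_k 'd_k ('d_l F) =
    T - N%:R * n%:R * 'd_l F + n%:R * 'd_l F + 'X * 'd_l ('d_l F).
  rewrite (bigD1 l) //= mulrDr addrC; congr (_ + _).
  have -> : N%:R * n%:R * 'd_l F =
      n%:R * 'd_l F + \sum_(k | k != l) n%:R * 'd_l F.
    rewrite -(bigD1 l (P := predT) (F := fun=> n%:R * 'd_l F)) //=.
    by rewrite sumr_const card_ord -[RHS]mulr_natl mulrA.
  rewrite opprD addrA addrAC subrK /T -sumrB mulr_sumr.
  apply: eq_bigr => k kl.
  have := linear_mul_pmderiv2 k l; rewrite (negPf kl) (pmderiv_comm l k) => E.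
  have -> : 'X * 'd_k ('d_l F) = ('X - z k) * 'd_k ('d_l F) + z k * 'd_k ('d_l F).
    by ring.
  by rewrite E sub0r mulNr addrC.
(* This is [d_l] applied to [deriv_exp_hyp_poly], the factors in x alone being constants for
   [d_l]. *)
have EV : 'X * ('X - 1) * ('d_l F)^`() =
    n%:R * ('X *+ 2 - 1) * 'd_l F - ('X - 1) * ('X * \sum_k 'd_k ('d_l F)).
  rewrite pmderiv_deriv.
  have dX21 : 'd_l ('X *+ 2 - 1) = 0.
    have dX : 'd_l 'X = 0 by exact: pmderivX.
    by rewrite mulr2n -addrA pmderivD dX pmderiv_X1 addr0.
  have E := congr1 (pmderiv l) deriv_exp_hyp_poly.
  rewrite pmderivM pmderiv_XX1 mul0r add0r in E; rewrite E.
  rewrite pmderivB -!mulrA pmderiv_natM pmderivM dX21 mul0r add0r.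
  rewrite (mulrA 'X) pmderivM pmderiv_XX1 mul0r add0r pmderiv_sum.
  under eq_bigr do rewrite pmderiv_comm.
  by rewrite -mulrA (mulrCA 'X).
have EH : H^`() = 'd_l F + ('X - 1) * ('d_l F)^`().
  by rewrite /H derivM derivB derivX derivC subr0 mul1r.
rewrite EH.
have E2 : ('X - z l) * 'd_l ('d_l F) = (1 - n%:R) * 'd_l F.
  by have := linear_mul_pmderiv2 l l; rewrite eqxx.
exact: (hypergeometric_elimination j (linear_mul_pmderiv l) E2 ET ES EV).
Qed.

(** The coefficients of the operator are free of x, so it commutes with taking the coefficient of
    [x^i]. Keeping [a], [b], [c] as variables gives the conclusion the shape of [D1]. *)
Lemma hypergeometric_coef (j i : nat) (a b c : R) l (P := F`_i) :
    (i + j)%:R = 0 :> R ->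
    a = - (N.+2 * n + j)%:R -> b = - n%:R -> c = 1 - (N.+1 * n + j)%:R ->
  'X_l * (1 - 'X_l) * mderiv l (mderiv l P)
  + \sum_(k | k != l) 'X_k * (1 - 'X_l) * mderiv l (mderiv k P)
  + (c%:MP - (a + b + 1) *: 'X_l) * mderiv l P
  - \sum_(k | k != l) (b *: 'X_k) * mderiv k P
  - (a * b) *: P = 0.
Proof.
move=> ij0 Ea Eb Ec.
have EH (H : {poly A}) : ('X * H^`() + j%:R * H)`_i = 0.
  transitivity (i%:R * H`_i + j%:R * H`_i); last first.
    by rewrite -mulrDl -natrD -mpolyC_nat ij0 mpolyC0 mul0r.
  rewrite coefD -polyC_natr coefCM coefXM; congr (_ + _).
  (* At [i = 0] the product [x H'] has no constant term, in agreement with the factor [i]. *)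
  case: i {ij0 P} => [|i] /=; first by rewrite mul0r.
  by rewrite coef_deriv mulr_natl.
have := congr1 (fun Q : {poly A} => Q`_i) (hypergeometric_pmderiv j l).
rewrite EH => E; rewrite -[RHS]E.
have natP m (Q : {poly A}) : (m%:R * Q)`_i = m%:R *: Q`_i.
  by rewrite -polyC_natr coefCM scaler_nat mulr_natl.
rewrite coefB !coefD; congr (_ + _ + _ + _ + _).
- by rewrite -polyC1 -polyCB -polyCM coefCM !coef_pmderiv.
- rewrite -polyC1 -polyCB coefCM coef_sum mulr_sumr; apply: eq_bigr => k _.
  by rewrite coefCM !coef_pmderiv mulrA (mulrC _ 'X_k).
- have -> : 1 - (N.+1 * n + j)%:R - (1 - (N.+3 * n + j)%:R) * z l =
      (1 - (N.+1 * n + j)%:R - (1 - (N.+3 * n + j)%:R) * 'X_l)%:P.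
    by rewrite !polyCB polyCM !polyCB !polyC_natr polyC1.
  have abE : a + b + 1 = 1 - (N.+3 * n + j)%:R by rewrite Ea Eb; ring.
  rewrite coefCM coef_pmderiv -mul_mpolyC abE Ec.
  by rewrite !mpolyCB !mpolyC_nat mpolyC1.
- rewrite natP coef_sum scaler_sumr -sumrN; apply: eq_bigr => k _.
  by rewrite coefCM coef_pmderiv Eb scaleNr mulNr opprK scalerAl.
- by rewrite natP Ea Eb mulrNN -natrM mulnC.
Qed.

Lemma pmderiv2_neq_coef (i : nat) l m (P := F`_i) : l != m ->
  ('X_l - 'X_m) * mderiv l (mderiv m P) = n%:R *: mderiv m P - n%:R *: mderiv l P.
Proof.
move=> lm; have := congr1 (fun Q : {poly A} => Q`_i) (pmderiv2_neq lm).
rewrite -polyCB coefCM !coef_pmderiv => ->.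
rewrite coefB -!polyC_natr !coefCM !coef_pmderiv.
by rewrite !scaler_nat !mulr_natl.
Qed.

End CoefficientwiseDerivation.

(** * Specialization to ['F_p] and [n = (p - 1) / 2] *)

Theorem theoremA (p g : nat) (p_prime : prime p) (p_odd : odd p)
    (g_ge1 : (1 <= g)%N) (i j : nat)
    (hi : (1 <= i <= g)%N) (hj : (1 <= j <= g)%N) :
  (forall l : 'I_(2 * g - 1),
     D1 j l (coef_c p g ((i * p)%N%:Z - j%:Z)) = 0) /\
  (forall l m : 'I_(2 * g - 1), (l < m)%N ->
     D2 l m (coef_c p g ((i * p)%N%:Z - j%:Z)) = 0).
Proof.
have p0 : p%:R = 0 :> 'F_p by exact: pchar_Fp_0.
set n := ((p - 1) %/ 2)%N.
have n2 : (2 * n + 1)%:R = 0 :> 'F_p.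
  rewrite -p0; congr (_%:R).
  have := odd_double_half p; rewrite p_odd /n => <-.
  by rewrite add1n subn1 /= -muln2 mulnK // mulnC addn1.
have two0 : 2%:R != 0 :> 'F_p.
  apply/eqP => two0; move: n2; rewrite natrD natrM two0 mul0r add0r.
  by move/eqP; rewrite oner_eq0.
have half : 1 / 2%:R = - n%:R :> 'F_p.
  apply: (mulfI two0); rewrite mul1r divff // mulrN; apply/eqP.
  by rewrite -addr_eq0 addrC -natrM -(natrD _ _ 1) n2.
(* For a negative index the coefficient is 0 by definition, and both operators are linear. *)
case Ek: ((i * p)%N%:Z - j%:Z) => [k|k]; last first.
  have D0 l : mderiv l (0 : {mpoly 'F_p[2 * g - 1]}) = 0 by exact: mderiv0.
  split=> [l|l m _]; rewrite /coef_c /D1 /D2 !D0.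
  - rewrite !mulr0 scaler0 !big1 ?subrr ?addr0 ?subr0 // => r _.
      by rewrite D0 mulr0.
    by rewrite !D0 mulr0.
  - by rewrite mulr0 !scaler0 subrr addr0.
have kj : (k + j)%:R = 0 :> 'F_p.
  have -> : (k + j = i * p)%N by move/eqP: Ek; rewrite subr_eq => /eqP [].
  by rewrite natrM p0 mulr0.
(* With [N = 2 g - 1] variables, [1/2 = -n] turns [(2 g + 1)/2 - j] into [-((N + 2) n + j)], and
   [2 n = -1] turns [g] into [-(N + 1) n]. *)
have N1 : (2 * g - 1).+1 = (2 * g)%N by rewrite subn1 prednK // muln_gt0.
have Ea : par_a p g j = - ((2 * g - 1).+2 * n + j)%:R.
  rewrite N1 /par_a -[_ / _]mul1r mulrCA half mulrN.
  by rewrite -[(2 * g).+1]addn1 [in RHS]natrD natrM opprD.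
have Ec : par_c p g j = 1 - ((2 * g - 1).+1 * n + j)%:R.
  have ng : (2 * g * n)%:R = - g%:R :> 'F_p.
    apply/eqP; rewrite -addr_eq0 -natrD.
    have -> : (2 * g * n + g = (2 * n + 1) * g)%N by rewrite mulnDl mul1n mulnAC.
    by rewrite natrM n2 mul0r.
  by rewrite N1 /par_c natrD ng opprD opprK addrC.
split=> [l|l m lm]; first exact: (hypergeometric_coef l kj Ea half Ec).
rewrite /D2 half (pmderiv2_neq_coef _ n k); last by rewrite -val_eqE neq_ltn lm.
by rewrite !scaleNr opprK subrK subrr.
Qed.
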